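(* $n(4,10) \leq 320$; that is, there exists a $4$-regular graph of girth exactly $10$ with at most $320$ vertices.
   Context: Graphs are finite and simple. For integers $k\ge 2$, $g\ge 3$, a $(k,g)$-graph is a $k$-regular graph with girth $g$ (the length of a shortest cycle is exactly $g$). $n(k,g)$ denotes the smallest possible number of vertices of a $(k,g)$-graph. *)

(* Defs.v *)
From mathcomp Require Import all_boot.

Set Implicit Arguments.
Unset Strict Implicit.
Unset Printing Implicit Defensive.

Record sgraph := SGraph {
  vertex :> finType;
  adj : rel vertex;
  adj_sym : symmetric adj;
  adj_irr : irreflexive adj
}.

Definition regular (k : nat) (G : sgraph) : Prop :=
  forall x : G, #|[set y | adj x y]| = k.

(* [ucycle] also accepts the empty sequence and the back-and-forth walk
   [:: x; y] along an edge, hence the lower bound on the length. *)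
Definition graph_cycle (G : sgraph) (c : seq G) : Prop :=
  ucycle (@adj G) c /\ 2 < size c.

Definition has_girth (G : sgraph) (g : nat) : Prop :=
  (exists2 c : seq G, graph_cycle c & size c = g) /\
  (forall c : seq G, graph_cycle c -> g <= size c).

Definition kg_graph (k g : nat) (G : sgraph) : Prop :=
  regular k G /\ has_girth G g.

(* [is_n k g m] means n(k,g) = m. As a relation, the minimum needs neither a
   default value nor the theorem that a (k,g)-graph always exists. *)
Definition is_n (k g m : nat) : Prop :=
  (exists2 G : sgraph, kg_graph k g G & #|G| = m) /\
  (forall G : sgraph, kg_graph k g G -> m <= #|G|).

(* Main.v *)
Require Import Defs.
From mathcomp Require Import all_boot.
From mathcomp Require Import zmodp.
From Stdlib Require Import Classical.

Set Implicit Arguments.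
Unset Strict Implicit.
Unset Printing Implicit Defensive.

(** The graph is a voltage lift: its vertices are the pairs of a base vertex in
    ['I_8] and an element of the group Heis(F_2) x C_5 of order 40, where
    Heis(F_2), isomorphic to D_4, consists of the unitriangular matrices
    [[1,a,c],[0,1,b],[0,0,1]] over F_2. The group acts on the graph by left
    multiplication, so any cycle can be moved to pass through the identity element
    over some base vertex, and it is enough to inspect the short non-backtracking
    walks from eight vertices. The voltages were found by a randomised
    backtracking computer search over the groups of order 40. *)

Section Walks.

Variables (T : eqType) (nbrs : T -> seq T).

(* [n] bounds the number of interior vertices of the walk. Conditionals replace
   the boolean connectives, which [vm_compute] evaluates on both sides. *)
Fixpoint nb_walk (n : nat) (p x z : T) : bool :=
  has (fun y => if y == p then false else if y == z then true else
         if n is n'.+1 then nb_walk n' x y z else false)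
      (nbrs x).

Definition short_cycle (n : nat) (z : T) : bool :=
  has (fun w => nb_walk n z w z) (nbrs z).

(** The search refuses only a step back to [p], the vertex visited just before [x]. Distinct
    vertices never force one, except that an empty [s] steps straight to [z], which must then differ
    from [p]. *)
Lemma nb_walkP (n : nat) (p x z : T) (s : seq T) :
  path (fun a b => b \in nbrs a) x (rcons s z) -> uniq (x :: s) ->
  z \notin x :: s -> p \notin s -> (s = [::] -> p != z) -> size s <= n ->
  nb_walk n p x z.
Proof.
elim: s n p x => [|y s IHs] n p x.
  rewrite /= andbT => xz _ _ _ /(_ erefl) pz _.
  by case: n => [|n]; apply/hasP; exists z; rewrite // eqxx eq_sym (negPf pz).
case: n => [|n] //= /andP[xy yz] /andP[xNs Us].
rewrite !inE !negb_or => /and3P[zx zy zs] /andP[py ps] _ sn.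
apply/hasP; exists y => //; rewrite eq_sym (negPf py); case: eqP => // _.
move: xNs; rewrite inE negb_or => /andP[xy' xs].
by apply: IHs => //; [rewrite inE negb_or zy | rewrite eq_sym].
Qed.

Lemma short_cycleP (n : nat) (z : T) (c : seq T) :
  cycle (fun a b => b \in nbrs a) (z :: c) -> uniq (z :: c) ->
  1 < size c -> size c <= n.+1 -> short_cycle n z.
Proof.
case: c => [|w [|y c]] // /andP[zw wz] /andP[zc Uc] _ cn.
(* [z] is both predecessor and target; the interior [y :: c] is nonempty, so closing up is not a
   backtrack. *)
apply/hasP; exists w => //; apply: (@nb_walkP n z w z (y :: c)) => //.
by move: zc; rewrite inE negb_or => /andP[].
Qed.

End Walks.

Definition elt : Type := (bool * bool * bool * 'I_5)%type.

Definition mul (g h : elt) : elt :=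
  let: (a, b, c, t) := g in
  let: (a', b', c', t') := h in
  (a (+) a', b (+) b', c (+) c' (+) (a && b'), Zp_add t t').

Definition inv (g : elt) : elt :=
  let: (a, b, c, t) := g in (a, b, c (+) (a && b), Zp_opp t).

Definition one : elt := (false, false, false, Zp0).

Lemma mulA (g h k : elt) : mul g (mul h k) = mul (mul g h) k.
Proof.
case: g h k => [[[a b] c] t] [[[a' b'] c'] t'] [[[a'' b''] c''] t''] /=.
rewrite Zp_addA !addbA; congr (_, _, _, _).
by case: a a' b' b'' c c' c'' => [] [] [] [] [] [] [].
Qed.

Lemma mul1 (g : elt) : mul one g = g.
Proof. by case: g => [[[[] []] []] t] /=; rewrite Zp_add0z. Qed.

Lemma mulg1 (g : elt) : mul g one = g.
Proof. by case: g => [[[[] []] []] t] /=; rewrite Zp_addC Zp_add0z. Qed.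

Lemma mulV (g : elt) : mul (inv g) g = one.
Proof. by case: g => [[[[] []] []] t] /=; rewrite Zp_addNz. Qed.

Lemma mulgV (g : elt) : mul g (inv g) = one.
Proof. by case: g => [[[[] []] []] t] /=; rewrite Zp_addC Zp_addNz. Qed.

Lemma mulI (g : elt) : injective (mul g).
Proof. by apply: (can_inj (g := mul (inv g))) => h; rewrite mulA mulV mul1. Qed.

Definition vert : Type := ('I_8 * elt)%type.

Definition dart (i a b c t : nat) : vert :=
  (inZp i, (odd a, odd b, odd c, inZp t)).

(* Row [i] lists the darts leaving the base vertex [i]: [dart j a b c t] has
   target [j] and voltage [(a, b, c, t)]. The two loops, at the base vertices 0
   and 7, appear once in each direction. *)
Definition dart_table : seq (seq vert) :=
    [:: [:: dart 0 0 1 0 1; dart 0 0 1 0 4; dart 1 0 0 0 0; dart 2 0 0 0 0];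
        [:: dart 0 0 0 0 0; dart 2 1 0 0 3; dart 3 0 0 0 0; dart 4 0 0 0 0];
        [:: dart 0 0 0 0 0; dart 1 1 0 0 2; dart 3 0 0 1 4; dart 4 0 0 1 3];
        [:: dart 1 0 0 0 0; dart 2 0 0 1 1; dart 5 0 0 0 0; dart 6 0 0 0 0];
        [:: dart 1 0 0 0 0; dart 2 0 0 1 2; dart 5 1 1 0 2; dart 6 1 1 0 4];
        [:: dart 3 0 0 0 0; dart 4 1 1 1 3; dart 6 0 1 1 4; dart 7 0 0 0 0];
        [:: dart 3 0 0 0 0; dart 4 1 1 1 1; dart 5 0 1 1 1; dart 7 0 0 1 2];
        [:: dart 5 0 0 0 0; dart 6 0 0 1 3; dart 7 1 0 0 2; dart 7 1 0 0 3]].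

Definition darts (i : 'I_8) : seq vert := nth [::] dart_table i.

Definition act (g : elt) (x : vert) : vert := (x.1, mul g x.2).

Definition nbrs (x : vert) : seq vert := map (act x.2) (darts x.1).

Definition lift_adj : rel vert := fun x y => y \in nbrs x.

Lemma act_inj (g : elt) : injective (act g).
Proof.
move=> [i h] [j k] eq_act.
by move: (congr1 fst eq_act) (congr1 snd eq_act) => /= -> /mulI ->.
Qed.

Lemma forall_base (P : pred 'I_8) :
  all (fun i => P (inZp i)) (iota 0 8) -> forall i, P i.
Proof.
move=> /allP aP i; have := aP i; rewrite mem_iota ltn_ord => /(_ isT).
by rewrite valZpK.
Qed.

(** Voltages multiply on the right, so left translation commutes with them. *)
Lemma nbrs_act (g : elt) (x : vert) : nbrs (act g x) = map (act g) (nbrs x).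
Proof.
rewrite /nbrs -map_comp; apply: eq_map => d.
by rewrite /act /= mulA.
Qed.

Lemma lift_adj_act (g : elt) (x y : vert) :
  lift_adj (act g x) (act g y) = lift_adj x y.
Proof. by rewrite /lift_adj nbrs_act (mem_map (@act_inj g)). Qed.

Lemma darts_inv (i : 'I_8) :
  all (fun d => (i, inv d.2) \in darts d.1) (darts i).
Proof. by move: i; apply: forall_base; vm_compute. Qed.

Lemma uniq_darts (i : 'I_8) : uniq (darts i) && (size (darts i) == 4).
Proof. by move: i; apply: forall_base; vm_compute. Qed.

(** A base loop of trivial voltage would lift to loops. *)
Lemma darts_one (i : 'I_8) : (i, one) \notin darts i.
Proof. by move: i; apply: forall_base; vm_compute. Qed.

Lemma lift_adj_sym : symmetric lift_adj.
Proof.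
suff adjS x y : lift_adj x y -> lift_adj y x.
  by move=> x y; apply/idP/idP; exact: adjS.
case: x => i g /mapP[[j s] ds ->]; have /allP/(_ _ ds) /= ds' := darts_inv i.
apply/mapP; exists (i, inv s) => //.
by rewrite /act /= -mulA mulgV mulg1.
Qed.

Lemma lift_adj_irr : irreflexive lift_adj.
Proof.
move=> [i g]; apply/negP=> /mapP[[j s] /= ds eq_act].
have ij : i = j := congr1 fst eq_act; have : g = mul g s := congr1 snd eq_act.
rewrite -{1}[g]mulg1 => /mulI s1.
by have := darts_one i; rewrite s1 {1}ij ds.
Qed.

Definition lift : sgraph := SGraph lift_adj_sym lift_adj_irr.

Lemma card_lift : #|lift| = 320.
Proof. by rewrite /= !card_prod !card_bool !card_ord. Qed.

Lemma lift_regular : regular 4 lift.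
Proof.
move=> x; have /andP[Ud /eqP sz] := uniq_darts x.1.
have Un : uniq (nbrs x) by rewrite (map_inj_uniq (@act_inj _)).
by rewrite cardsE (card_uniqP Un) size_map.
Qed.

(** The start, its first neighbour and at most 7 interior vertices cover the cycle lengths 3 to
    9. *)
Lemma no_short_cycle (i : 'I_8) : ~~ short_cycle nbrs 7 (i, one).
Proof. by move: i; apply: forall_base; vm_compute. Qed.

Lemma lift_girth_ge (c : seq lift) : graph_cycle c -> 10 <= size c.
Proof.
case: c => [|x c] [/andP[Cc Uc] sz] //; rewrite leqNgt; apply/negP => c10.
have := no_short_cycle x.1; apply/negP/negPn.
have -> : (x.1, one) = act (inv x.2) x :> vert by rewrite /act mulV.
apply: (@short_cycleP _ nbrs 7 _ (map (act (inv x.2)) c)).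
- by rewrite -map_cons (mono_cycle (lift_adj_act _)).
- by rewrite -map_cons (map_inj_uniq (@act_inj _)).
- by rewrite size_map.
- by rewrite size_map -ltnS.
Qed.

(* The loop at the base vertex 0 carries an element of order 10. *)
Definition ten_cycle : seq lift := [seq dart 0 0 k 0 k | k <- iota 0 10].

Lemma ten_cycleP : graph_cycle ten_cycle.
Proof. by split=> //; apply/andP; split; vm_compute. Qed.

Lemma lift_kg : kg_graph 4 10 lift.
Proof.
split; first exact: lift_regular.
split; last exact: lift_girth_ge.
by exists ten_cycle; first exact: ten_cycleP.
Qed.

(** Descent on the order: excluded middle decides whether a smaller (k,g)-graph exists; if none
    does, [m] is the minimum. *)
Lemma is_n_exists (k g m : nat) (G : sgraph) :
  kg_graph k g G -> #|G| = m -> exists2 n, is_n k g n & n <= m.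
Proof.
elim/ltn_ind: m G => m IHm G kgG Gm.
case: (classic (exists2 H : sgraph, kg_graph k g H & #|H| < m)).
  case=> H kgH Hm; have [n nmin nH] := IHm _ Hm H kgH erefl.
  by exists n => //; apply: leq_trans nH (ltnW Hm).
move=> noH; exists m => //; split; first by exists G.
by move=> H kgH; rewrite leqNgt; apply/negP => Hm; apply: noH; exists H.
Qed.

Theorem mainTheorem4 :
  (exists2 n : nat, is_n 4 10 n & n <= 320) /\
  (exists2 G : sgraph, kg_graph 4 10 G & #|G| <= 320).
Proof.
split; first exact: is_n_exists lift_kg card_lift.
by exists lift; [exact: lift_kg | rewrite card_lift].
Qed.
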